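(* Let $f:2^E \to \mathbb{R}_+$ be a monotone submodular function that can be decomposed as $f=g+h$, where $g:2^E \to \mathbb{R}_+$ is monotone submodular and $h:2^E \to \mathbb{R}_+$ is M$^\natural$-concave. Assume that we have value oracles of $g$ and $h$. Then, for an integer $k \in \mathbb{Z}_+$ and a constant $\epsilon > 0$, we can find in polynomial time a random subset $X \subseteq E$ of size $k$ such that $\mathbb{E}[f(X)] \geq (1-\gamma_h / e-\epsilon)f(O)$, where $O$ is an optimal solution of $\max\{f(X) : |X| \leq k\}$.
   Context: $E$ is a finite ground set. A set function $f:2^E\to\mathbb{R}$ is monotone if $f(X)\le f(Y)$ for all $X\subseteq Y\subseteq E$, and submodular if $f(X)+f(Y)\ge f(X\cap Y)+f(X\cup Y)$ for all $X,Y\subseteq E$. A set function $h:2^E\to\mathbb{R}$ is M$^\natural$-concave if for any $X,Y\subseteq E$ and $i\in X\setminus Y$, either $h(X)+h(Y)\le h(X-i)+h(Y+i)$, or there exists $j\in Y\setminus X$ with $h(X)+h(Y)\le h(X-i+j)+h(Y+i-j)$. For a decomposition $f=g+h$ of a monotone submodular $f:2^E\to\mathbb{R}_+$ into a monotone submodular $g:2^E\to\mathbb{R}_+$ and an M$^\natural$-concave $h:2^E\to\mathbb{R}_+$, the $h$-curvature $\gamma_h$ is the minimum $\gamma$ such that $h(X)\ge(1-\gamma)f(X)$ for every $X\subseteq E$, i.e. $\gamma_h = 1-\min_{X\subseteq E} h(X)/f(X) = \max_{X\subseteq E} g(X)/f(X)$, with the convention $0/0:=\infty$. *)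

(* Defs.v *)
(* MathComp / MathComp-Analysis. *)
From mathcomp Require Import all_boot all_order all_algebra.
From mathcomp Require Import constructive_ereal reals.

Set Implicit Arguments.
Unset Strict Implicit.
Unset Printing Implicit Defensive.

Import Order.TTheory GRing.Theory Num.Theory.
Local Open Scope ring_scope.

Section SetFunctions.
Variables (R : realType) (E : finType).
Implicit Types f g h : {set E} -> R.

Definition nonneg f := forall X, 0 <= f X.

Definition monotone f := forall X Y : {set E}, X \subset Y -> f X <= f Y.

Definition submodular f :=
  forall X Y : {set E}, f (X :&: Y) + f (X :|: Y) <= f X + f Y.

Definition Mnat_concave h :=
  forall (X Y : {set E}) (i : E), i \in X :\: Y ->
    h X + h Y <= h (X :\ i) + h (i |: Y) \/
    exists2 j : E, j \in Y :\: X &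
      h X + h Y <= h (j |: (X :\ i)) + h ((i |: Y) :\ j).

(* h(X) / f(X), with the convention 0/0 = +oo (in the intended use
   0 <= h <= f, so f(X) = 0 forces h(X) = 0). *)
Definition curv_ratio f h (X : {set E}) : \bar R :=
  if f X == 0 then +oo%E else (h X / f X)%:E.

(* The h-curvature of f.  It is a real number unless f is identically 0, in
   which case the convention above makes it -oo. *)
Definition h_curvature f h : \bar R :=
  (1 - \big[Order.min/+oo]_(X : {set E}) curv_ratio f h X)%E.

Definition optimal f (k : nat) (O : {set E}) :=
  (#|O| <= k)%N /\ forall X : {set E}, (#|X| <= k)%N -> f X <= f O.

End SetFunctions.

(* Randomized computations: binary trees branching on independent fair coins. *)
Inductive rnd (A : Type) : Type :=
  | Done of A
  | Coin of rnd A & rnd A.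

Fixpoint bind (A B : Type) (t : rnd A) (k : A -> rnd B) : rnd B :=
  match t with
  | Done a => k a
  | Coin l r => Coin (bind l k) (bind r k)
  end.

Fixpoint mean (R : realType) (A : Type) (phi : A -> R) (t : rnd A) : R :=
  match t with
  | Done a => phi a
  | Coin l r => (mean phi l + mean phi r) / 2
  end.

Fixpoint surely (A : Type) (P : A -> Prop) (t : rnd A) : Prop :=
  match t with
  | Done a => P a
  | Coin l r => surely P l /\ surely P r
  end.

(* The machine: a random-access machine whose memory consists of arrays of
   natural numbers, of real numbers and of subsets of the ground set.  A cell is
   addressed by an array name, fixed in the program text, and a computed index.
   Programs are pure syntax: they mention neither the ground set nor the oracles
   nor any real constant other than the natural numbers, so one program runs on
   all instances.

   Numbers are only added, subtracted and compared, and sets are only changed or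
   tested one element at a time, copied, or passed to the oracles.  Without
   multiplication the bit length of the numbers computed in t steps is O(t) plus
   the length of the oracle answers, so that unit cost is polynomially related to
   bit cost when the oracles are rational-valued; a polynomial bound here is also
   one on a real RAM with the four operations. *)

Inductive nexp : Type :=
  | NLit of nat
  | NGet of nat & nexp
  | NAdd of nexp & nexp
  | NSub of nexp & nexp.  (* truncated *)

(* Elements of the ground set are designated by their index below its size. *)
Inductive sexp : Type :=
  | SEmpty
  | SGet of nat & nexp
  | SIns of sexp & nexp
  | SDel of sexp & nexp.

Inductive rexp : Type :=
  | RLit of nat
  | RGet of nat & nexp
  | RAdd of rexp & rexp
  | RSub of rexp & rexp
  | ROracleG of sexp
  | ROracleH of sexp.

Inductive bexp : Type :=
  | BLeN of nexp & nexp
  | BLeR of rexp & rexp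
  | BMem of nexp & sexp
  | BNot of bexp
  | BAnd of bexp & bexp.

(* For a e c runs c as many times as the value of e on entry, the cell 0 of the
   array a of naturals holding the iteration number 0, 1, ... at the start of
   each iteration.  There is no unbounded loop, hence every program terminates;
   no computation with a polynomial time bound is lost, since one can loop up to
   the bound and test at each iteration whether to go on. *)
Inductive cmd : Type :=
  | NSet of nat & nexp & nexp
  | RSet of nat & nexp & rexp
  | SSet of nat & nexp & sexp
  | Toss of nat & nexp
  | Seq of cmd & cmd
  | If of bexp & cmd & cmd
  | For of nat & nexp & cmd.

Definition upd (T : Type) (m : nat -> nat -> T) (a i : nat) (v : T) :
    nat -> nat -> T :=
  fun b j => if (b == a) && (j == i) then v else m b j.

Section Semantics.
Variables (R : realType) (E : finType) (g h : {set E} -> R).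

Record state : Type := State {
  nmem : nat -> nat -> nat;
  rmem : nat -> nat -> R;
  smem : nat -> nat -> {set E};
  time : nat
}.

(* The singleton of the element of index i, empty if i is out of range. *)
Definition elt (i : nat) : {set E} := [set x : E | nat_of_ord (enum_rank x) == i].

Fixpoint neval (s : state) (e : nexp) : nat :=
  match e with
  | NLit n => n
  | NGet a i => nmem s a (neval s i)
  | NAdd e1 e2 => (neval s e1 + neval s e2)%N
  | NSub e1 e2 => (neval s e1 - neval s e2)%N
  end.

Fixpoint seval (s : state) (e : sexp) : {set E} :=
  match e with
  | SEmpty => set0
  | SGet a i => smem s a (neval s i)
  | SIns e1 i => seval s e1 :|: elt (neval s i)
  | SDel e1 i => seval s e1 :\: elt (neval s i)
  end.

Fixpoint reval (s : state) (e : rexp) : R :=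
  match e with
  | RLit n => n%:R
  | RGet a i => rmem s a (neval s i)
  | RAdd e1 e2 => reval s e1 + reval s e2
  | RSub e1 e2 => reval s e1 - reval s e2
  | ROracleG e1 => g (seval s e1)
  | ROracleH e1 => h (seval s e1)
  end.

Fixpoint beval (s : state) (e : bexp) : bool :=
  match e with
  | BLeN e1 e2 => (neval s e1 <= neval s e2)%N
  | BLeR e1 e2 => reval s e1 <= reval s e2
  | BMem i e1 => elt (neval s i) :&: seval s e1 != set0
  | BNot e1 => ~~ beval s e1
  | BAnd e1 e2 => beval s e1 && beval s e2
  end.

Definition set_n (s : state) (a i v : nat) : state :=
  State (upd (nmem s) a i v) (rmem s) (smem s) (time s).
Definition set_r (s : state) (a i : nat) (v : R) : state :=
  State (nmem s) (upd (rmem s) a i v) (smem s) (time s).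
Definition set_s (s : state) (a i : nat) (v : {set E}) : state :=
  State (nmem s) (rmem s) (upd (smem s) a i v) (time s).
Definition tick (s : state) : state :=
  State (nmem s) (rmem s) (smem s) (time s).+1.

(* Runs the iterations i, i + 1, ..., i + m - 1. *)
Fixpoint loop (body : nat -> state -> rnd state) (m i : nat) (s : state) :
    rnd state :=
  match m with
  | 0%N => Done s
  | m'.+1 => bind (body i s) (loop body m' i.+1)
  end.

(* Time counts the assignments, coin tosses, tests, loop entries and loop
   iterations executed.  The expressions evaluated in each of these are part of
   the program, so their size, and in particular the number of oracle calls in
   them, is bounded by a constant of the program. *)
Fixpoint exec (c : cmd) (s : state) : rnd state :=
  match c with
  | NSet a i e => Done (tick (set_n s a (neval s i) (neval s e)))
  | RSet a i e => Done (tick (set_r s a (neval s i) (reval s e)))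
  | SSet a i e => Done (tick (set_s s a (neval s i) (seval s e)))
  | Toss a i => Coin (Done (tick (set_n s a (neval s i) 0)))
                     (Done (tick (set_n s a (neval s i) 1)))
  | Seq c1 c2 => bind (exec c1 s) (exec c2)
  | If b c1 c2 => exec (if beval s b then c1 else c2) (tick s)
  | For a e c1 =>
      loop (fun i s' => exec c1 (tick (set_n s' a 0 i))) (neval s e) 0 (tick s)
  end.

Definition init (k : nat) : state :=
  State (upd (upd (fun _ _ => 0%N) 0 0 #|E|) 1 0 k)
        (fun _ _ => 0) (fun _ _ => set0) 0.

Definition output (s : state) : {set E} := smem s 0 0.

Definition run (c : cmd) (k : nat) : rnd state := exec c (init k).

End Semantics.

(* Main.v *)
(* A deterministic non-oblivious local search in the style of Buchbinder and
   Feldman.  Let L = l + 1 be large.  The current solution S, always of size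
   min(k, n), carries a labelling of its elements by {1, ..., L}; for a set J of
   labels, S_J is the set of the elements of S with label in J.  The potential is
   sum_J w_|J| g(S_J) + c h(S), and a move exchanges u in S for v, giving v an
   arbitrary label (v = u relabels).  If no move gains more than W, summing over
   the labels and over the exchanges of an optimum O gives
     c (g(O) + h(O)) - d g(O) <= c (g(S) + h(S)) + |S| W,
   where d / c = (1 + 1/L)^(-L) <= 1/e + 1/L: the sums of g(S_J) - g(S_J - u)
   over a label class are bounded by submodularity, and the weights w are chosen
   so that all the g(S_J) but g(S) and g(set0) cancel; the sum of the exchange
   gains of h is bounded below by h(O) - h(S) because h is M-natural-concave.
   With steepest ascent, as long as S is worse than the target the potential,
   which is O(f(O)), grows by a constant fraction of f(O) / |S| per round.  Hence
   one of the first O(n) solutions is good, and the program keeps the best. *)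

Require Import Defs.
From mathcomp Require Import all_boot all_order all_algebra.
From mathcomp Require Import constructive_ereal reals sequences exp.
From mathcomp Require Import zify ring lra.

Set Implicit Arguments.
Unset Strict Implicit.
Unset Printing Implicit Defensive.

Import Order.TTheory GRing.Theory Num.Theory.
Local Open Scope ring_scope.

(** * M-natural-concave and submodular functions *)

Section MnatConcave.
Variables (R : realType) (E : finType) (h : {set E} -> R).
Hypothesis hM : Mnat_concave h.
Implicit Types S T : {set E}.

(** When [T] is contained in [S], the second alternative of the exchange axiom has no candidate. *)
Lemma Mnat_exchange_sub S T x : T \subset S -> x \in S :\: T ->
  h S + h T <= h (S :\ x) + h (x |: T).
Proof.
move=> sTS xST; case: (hM xST) => // -[y]; rewrite !inE => /andP[yS yT].
by rewrite (subsetP sTS) in yS.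
Qed.

(** Induction on the distance between [S] and [T]. While [S :\: T] is nonempty, the exchange axiom
    moves [T] one step towards [S], at price [a u] or [a u + b v]; once [S] is contained in [T], the
    elements of [T :\: S] are removed one at a time. *)
Lemma Mnat_local_bound (a b : E -> R) S T :
  (forall u, u \in S :\: T -> h (S :\ u) - h S <= a u) ->
  (forall v, v \in T :\: S -> h (v |: S) - h S <= b v) ->
  (forall u v, u \in S :\: T -> v \in T :\: S ->
     h (v |: S :\ u) - h S <= a u + b v) ->
  h T - h S <= \sum_(u in S :\: T) a u + \sum_(v in T :\: S) b v.
Proof.
have [m] := ubnP (#|S :\: T| + #|T :\: S|).
elim: m T => // m IHm T ltm ha hb hab.
have [ST0|[u uST]] := set_0Vmem (S :\: T); last first.
  have /[!inE]/andP[uT uS] := uST.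
  have SuT : S :\: (u |: T) = (S :\: T) :\ u
    by apply/setP => z; rewrite !inE negb_or andbA.
  have TuS : (u |: T) :\: S = T :\: S.
    by apply/setP => z; rewrite !inE; case: eqP => // ->; rewrite uS.
  have cST := cardsD1 u (S :\: T); rewrite uST /= in cST.
  have sumST := big_setD1 (A := S :\: T) u (F := a) uST.
  case: (hM uST) => [hle|[v vTS hle]].
  - have := IHm (u |: T); rewrite SuT TuS => /(_ _ _ hb _) IH.
    have {}IH : h (u |: T) - h S <=
        \sum_(u0 in (S :\: T) :\ u) a u0 + \sum_(v in T :\: S) b v.
      apply: IH; first by lia.
        by move=> z /setD1P[_ /ha].
      by move=> z y /setD1P[_ /hab]; apply.
    rewrite sumST /=; have := ha _ uST; lra.
  - have /[!inE]/andP[vS vT] := vTS.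
    have SuvT : S :\: ((u |: T) :\ v) = (S :\: T) :\ u.
      apply/setP => z; rewrite !inE; have [->|] := eqVneq z v.
        by rewrite (negPf vS) !andbF.
      by rewrite negb_or /= andbA.
    have TuvS : ((u |: T) :\ v) :\: S = (T :\: S) :\ v.
      apply/setP => z; rewrite !inE; have [->|] := eqVneq z u.
        by rewrite uS !andbF.
      by case: (z \in S); rewrite ?andbF.
    have cTS := cardsD1 v (T :\: S); rewrite vTS /= in cTS.
    have sumTS := big_setD1 (A := T :\: S) v (F := b) vTS.
    have := IHm ((u |: T) :\ v); rewrite SuvT TuvS => IH.
    have {}IH : h ((u |: T) :\ v) - h S <=
        \sum_(u0 in (S :\: T) :\ u) a u0 + \sum_(v0 in (T :\: S) :\ v) b v0.
      apply: IH; first by lia.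
      - by move=> z /setD1P[_ /ha].
      - by move=> z /setD1P[_ /hb].
      - by move=> z y /setD1P[_ zST] /setD1P[_ yTS]; apply: hab.
    rewrite sumST sumTS /=; have := hab _ _ uST vTS; lra.
have [TS0|[v vTS]] := set_0Vmem (T :\: S).
  have -> : T = S.
    by apply/eqP; rewrite eqEsubset -!setD_eq0 ST0 TS0 eqxx.
  by rewrite setDv !big_set0 subrr addr0.
have /[!inE]/andP[vS vT] := vTS.
have sST : S \subset T by rewrite -setD_eq0 ST0.
have hle := Mnat_exchange_sub sST vTS.
have SvT : S :\: (T :\ v) = S :\: T.
  by apply/setP => z; rewrite !inE; case: eqP => // ->; rewrite (negPf vS) !andbF.
have TvS : (T :\ v) :\: S = (T :\: S) :\ v by rewrite !setDDl setUC.
have cTS := cardsD1 v (T :\: S); rewrite vTS /= in cTS.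
have sumTS := big_setD1 (A := T :\: S) v (F := b) vTS.
have := IHm (T :\ v); rewrite SvT TvS => IH.
have {}IH : h (T :\ v) - h S <=
    \sum_(u0 in S :\: T) a u0 + \sum_(v0 in (T :\: S) :\ v) b v0.
  apply: IH => //; first by lia.
    by move=> z /setD1P[_ /hb].
  by move=> z y zST /setD1P[_ yTS]; apply: hab.
rewrite sumTS /=; have := hb _ vTS; lra.
Qed.

(* Dual form of Murota's upper-bound lemma for valuated matroids: by weak
   duality [a] and [b] bound a maximum weight perfect matching of single
   exchanges.  Shifting [a] up and [b] down by the same [l] makes deletions and
   insertions admissible separately, and the shift cancels in the sum. *)
Lemma Mnat_exchange_bound (a b : E -> R) S T : #|S| = #|T| ->
  (forall u v, u \in S :\: T -> v \in T :\: S ->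
     h (v |: S :\ u) - h S <= a u + b v) ->
  h T - h S <= \sum_(u in S :\: T) a u + \sum_(v in T :\: S) b v.
Proof.
move=> cST hab.
have cD : #|S :\: T| = #|T :\: S|.
  by apply/eqP; rewrite -(eqn_add2l #|S :&: T|) cardsID setIC cardsID cST.
have [ST0|[u0 u0ST]] := set_0Vmem (S :\: T).
  have TS0 : T :\: S = set0 by apply/eqP; rewrite -cards_eq0 -cD ST0 cards0.
  have -> : T = S by apply/eqP; rewrite eqEsubset -!setD_eq0 ST0 TS0 eqxx.
  by rewrite setDv !big_set0 subrr addr0.
pose gap u := h (S :\ u) - h S - a u.
case: (@arg_maxP _ _ _ u0 [in S :\: T] gap u0ST) => u1 u1ST maxu1.
(* [l] is the least shift that makes every deletion admissible; it is tight at [u1]. *)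
have [l lE] : exists l, l = gap u1 by exists (gap u1).
(* Together with tightness at [u1], this local submodularity bounds the insertion of [v] by
   [b v - l]. *)
have submod u v : u \in S :\: T -> v \in T :\: S ->
    h (v |: S) + h (S :\ u) <= h S + h (v |: S :\ u).
  rewrite !inE => /andP[uT uS] /andP[vS vT].
  have -> : h S = h ((v |: S) :\ v).
    congr h; apply/setP => z; rewrite !inE; case: eqP => // ->.
    exact/negbTE.
  apply: Mnat_exchange_sub; last by rewrite !inE eqxx (negPf vS) andbF.
  by rewrite (subset_trans (subD1set _ _)) // subsetUr.
have := @Mnat_local_bound (fun u => a u + l) (fun v => b v - l) S T.
rewrite !big_split /= sumrN !sumr_const cD addrACA. rewrite subrr addr0; apply.
- by move=> u uST; have := maxu1 _ uST; rewrite lE /gap /=; lra.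
- by move=> v vTS; have := submod _ _ u1ST vTS; have := hab _ _ u1ST vTS;
    rewrite lE /gap /=; lra.
- by move=> u v uST vTS; have := hab _ _ uST vTS; lra.
Qed.

End MnatConcave.

Section Submodular.
Variables (R : realType) (E : finType) (g : {set E} -> R).
Hypothesis gS : submodular g.
Implicit Types A B C S : {set E}.

(** Diminishing returns: removing [u] last, when the rest of [C] is gone, loses at least as much as
    removing it from [A]. *)
Lemma submodular_deletion_sum A C : C \subset A ->
  \sum_(u in C) (g A - g (A :\ u)) <= g A - g (A :\: C).
Proof.
have [m] := ubnP #|C|; elim: m C => // m IHm C ltm sCA.
have [->|[u uC]] := set_0Vmem C; first by rewrite big_set0 setD0 subrr.
have uA := subsetP sCA _ uC.
rewrite (big_setD1 u) //=.
have := IHm (C :\ u); rewrite (cardsD1 u C) uC /= in ltm.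
move=> /(_ ltm (subset_trans (subD1set _ _) sCA)).
have := gS (A :\ u) (A :\: (C :\ u)).
have -> : (A :\ u) :&: (A :\: (C :\ u)) = A :\: C.
  by apply/setP => z; rewrite !inE; case: eqP => [->|]; rewrite ?uC //= ;
     case: (z \in A); rewrite ?andbF ?andbT.
have -> : (A :\ u) :|: (A :\: (C :\ u)) = A.
  by apply/setP => z; rewrite !inE; case: eqP => [->|]; rewrite ?uA //=;
     case: (z \in A); rewrite ?andbF.
lra.
Qed.

Lemma submodular_insertion_sum A B :
  g (A :|: B) - g A <= \sum_(v in B) (g (v |: A) - g A).
Proof.
have [m] := ubnP #|B|; elim: m B => // m IHm B ltm.
have [->|[v vB]] := set_0Vmem B; first by rewrite big_set0 setU0 subrr.
rewrite (big_setD1 v) //=.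
have := IHm (B :\ v); rewrite (cardsD1 v B) vB /= in ltm => /(_ ltm).
have [vA|vA] := boolP (v \in A).
  have -> : v |: A = A by apply/setUidPr; rewrite sub1set.
  have -> : A :|: B = A :|: B :\ v; last lra.
  by apply/setP => z; rewrite !inE; case: eqP => // ->; rewrite vA.
have := gS (v |: A) (A :|: (B :\ v)).
have -> : (v |: A) :|: (A :|: (B :\ v)) = A :|: B.
  apply/setP => z; rewrite !inE; case: eqP => [->|_]; rewrite ?vB ?orbT //=.
  by rewrite orbA orbb.
have -> : (v |: A) :&: (A :|: (B :\ v)) = A.
  by apply/setP => z; rewrite !inE; case: eqP => [->|]; rewrite ?(negPf vA) //=;
     case: (z \in A).
lra.
Qed.

Lemma submodular_marginal A B v : A \subset B -> v \notin B ->
  g (v |: B) - g B <= g (v |: A) - g A.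
Proof.
move=> sAB vB; have := gS (v |: A) B.
have -> : (v |: A) :&: B = A.
  apply/setP => z; rewrite !inE; case: eqP => [->|_].
    by rewrite (negPf vB) (contraNF (subsetP sAB v)).
  by apply/andP/idP => [[]//|zA]; rewrite (subsetP sAB).
rewrite -setUA (setUidPr sAB); lra.
Qed.

End Submodular.

(** * The potential *)

Section Weights.
Variable l : nat.

(* Up to a common factor, [(1 + 1/(l+1)) ^ (m-1) / (m * 'C(l+1, m))], scaled to
   be an integer.  The value at [m = 0] is irrelevant. *)
Definition weight m : nat :=
  l.+2 ^ m.-1 * l.+1 ^ (l.+1 - m) * (m.-1)`! * (l.+1 - m)`!.
(** With the same common factor divided out, this is (1 + 1/L)^L for L = [l.+1], and [loss_weight]
    is 1. *)
Definition hweight : nat := l.+2 ^ l.+1 * l`!.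
Definition loss_weight : nat := l.+1 ^ l.+1 * l`!.

(** This recurrence is what cancels, in [weight_telescope], every label set other than the empty and
    the full one. *)
Lemma weight_rec m : (0 < m <= l)%N ->
  (l.+2 * m * weight m = l.+1 * (l.+1 - m) * weight m.+1)%N.
Proof.
case: m => // m /= ml; rewrite /weight /=.
have -> : (l.+1 - m.+1 = (l.+1 - m.+2).+1)%N by lia.
by rewrite !factS !expnS; lia.
Qed.

Lemma weight_last : (l.+2 * weight l.+1 = hweight)%N.
Proof. by rewrite /weight /hweight subnn expn0 fact0 !muln1 mulnA -expnS. Qed.

Lemma weight_first : (l.+1 * weight 1 = loss_weight)%N.
Proof.
by rewrite /weight /loss_weight subSS subn0 expn0 fact0 mul1n muln1 mulnA -expnS.
Qed.

Lemma hweight_gt0 : (0 < hweight)%N.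
Proof. by rewrite muln_gt0 expn_gt0 fact_gt0. Qed.

(** The ratio of the two weights is q^(l+1) with q = 1 - 1/(l+2). Since 1 - x <= exp(-x), q^(l+2) <=
    1/e; dividing by q multiplies by 1 + 1/(l+1), which adds at most 1/(l+1). *)
Lemma loss_weight_le (R : realType) :
  loss_weight%:R <= ((expR 1)^-1 + l.+1%:R^-1) * hweight%:R :> R.
Proof.
set e1 : R := (expR 1)^-1; set q : R := l.+1%:R / l.+2%:R.
have l1 : (0 : R) < l.+1%:R by rewrite ltr0n.
have l2 : (0 : R) < l.+2%:R by rewrite ltr0n.
have qE : q = 1 - l.+2%:R^-1.
  rewrite /q -(natr1 l.+1); field.
  by rewrite [1 + _]addrC !natr1 lt0r_neq0.
have q0 : 0 <= q by rewrite divr_ge0 ?ltW.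
have qle : q ^+ l.+2 <= e1.
  have -> : e1 = expR (- l.+2%:R^-1) ^+ l.+2.
    by rewrite -expRM_natl mulrN divff ?lt0r_neq0// expRN.
  by rewrite lerXn2r ?nnegrE ?expR_ge0 // qE expR_ge1Dx.
have e1le : e1 <= 1.
  by rewrite invf_le1 ?expR_gt0 // (le_trans _ (expR_ge1Dx _)) // lerDl.
have lossE : loss_weight%:R = q ^+ l.+1 * hweight%:R :> R.
  rewrite /loss_weight /hweight !natrM !natrX mulrA exprMn exprVn.
  by rewrite divfK // expf_neq0 // lt0r_neq0.
rewrite lossE ler_wpM2r //.
have -> : q ^+ l.+1 = q ^+ l.+2 * (1 + l.+1%:R^-1).
  rewrite [q ^+ l.+2]exprS mulrAC /q -(natr1 l.+1) -[LHS]mul1r; congr (_ * _).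
  field; by rewrite ![1 + _]addrC !natr1 !lt0r_neq0.
have l1' : 0 <= l.+1%:R^-1 :> R by rewrite invr_ge0 ltW.
have := ler_wpM2r l1' qle; have := ler_wpM2r l1' e1le.
move: (q ^+ l.+2) (l.+1%:R^-1) (e1) qle => x y z; lra.
Qed.

(** A set arises as [J :\ i] with [i \in J] once for each label [i] outside it. *)
Lemma weight_double_count (R : realType) (phi : {set 'I_l.+1} -> R) :
  \sum_(J : {set 'I_l.+1})
     (weight #|J|)%:R * \sum_(i in J) phi (J :\ i) =
  \sum_(J : {set 'I_l.+1})
     ((l.+1 - #|J|) * weight #|J|.+1)%N%:R * phi J.
Proof.
under eq_bigr do rewrite big_distrr /=.
rewrite (exchange_big_dep predT) //=.
transitivity (\sum_i \sum_(J : {set 'I_l.+1} | i \notin J)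
                (weight #|J|.+1)%:R * phi J).
  apply: eq_bigr => i _.
  rewrite (reindex_onto (fun J => i |: J) (fun J => J :\ i)) /=; last first.
    by move=> J; apply: setD1K.
  apply: eq_big => [J|J].
    rewrite setU11 /=; apply/eqP/idP => [<-|/setU1K //].
    by rewrite !inE eqxx.
  case/andP=> _ /eqP JE; have iJ : i \notin J by rewrite -JE !inE eqxx.
  by rewrite JE cardsU1 iJ.
rewrite (exchange_big_dep predT) //=; apply: eq_bigr => J _.
rewrite sumr_const -[LHS]mulr_natl mulrA -natrM; congr ((_ * _)%:R * _).
have <- : #|~: J| = (l.+1 - #|J|)%N by rewrite cardsCs setCK card_ord.
by apply: eq_card => i; rewrite !inE.
Qed.

(** With m = [#|J|], the coefficient of [phi J] on the left is (l+2) m w_m - (l+1) (l+1-m) w_(m+1),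
    which vanishes for 0 < m < l+1. The factor [l.+1] matches the number of labels tried for each
    exchange in [swap_gain_sum]. *)
Lemma weight_telescope (R : realType) (phi : {set 'I_l.+1} -> R) :
  l.+1%:R * \sum_(J : {set 'I_l.+1})
     (weight #|J|)%:R * \sum_(i in J) (phi J - phi (J :\ i)) +
  \sum_(J : {set 'I_l.+1}) (weight #|J|)%:R * #|J|%:R * phi J =
  l.+1%:R * (hweight%:R * phi setT - loss_weight%:R * phi set0).
Proof.
have -> : \sum_(J : {set 'I_l.+1})
     (weight #|J|)%:R * \sum_(i in J) (phi J - phi (J :\ i)) =
   \sum_(J : {set 'I_l.+1}) (weight #|J|)%:R * #|J|%:R * phi J -
   \sum_(J : {set 'I_l.+1})
     ((l.+1 - #|J|) * weight #|J|.+1)%N%:R * phi J.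
  rewrite -weight_double_count -sumrB; apply: eq_bigr => J _.
  by rewrite sumrB sumr_const mulrBr -(mulrA _ _ (phi J)) (mulr_natl (phi J)).
rewrite mulrBr addrAC -{2}[\sum_J _ * _ * _]mul1r -mulrDl natr1.
rewrite !big_distrr -sumrB /=.
have T0 : set0 != [set: 'I_l.+1].
  by apply/eqP => /setP/(_ ord0); rewrite !inE.
rewrite (bigD1 setT) //= (bigD1 set0) //= big1 ?addr0.
  rewrite cardsT card_ord cards0 subnn mul0n !mul0r mulr0 subr0 mulr0.
  rewrite -weight_last -weight_first !natrM subn0; ring.
move=> J /andP[JT J0]; rewrite !mulrA -!natrM -mulrBl.
have -> : (l.+2 * weight #|J| * #|J|)%N =
          (l.+1 * ((l.+1 - #|J|) * weight #|J|.+1))%N.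
  rewrite mulnAC weight_rec ?mulnA //.
  rewrite card_gt0 J0 -ltnS -[X in (_ < X)%N](card_ord l.+1) -cardsT.
  by rewrite proper_card // properT.
by rewrite subrr mul0r.
Qed.

(** The telescoping identity at a constant [phi]; it supplies the coefficient of [g O]. *)
Lemma weight_total (R : realType) :
  \sum_(J : {set 'I_l.+1}) (weight #|J|)%:R * #|J|%:R =
  l.+1%:R * (hweight%:R - loss_weight%:R) :> R.
Proof.
have := weight_telescope (fun=> 1 : R).
rewrite big1 ?mulr0 ?add0r => [|J _]; last first.
  by rewrite big1 ?mulr0 // => i _; rewrite subrr.
by under eq_bigr do rewrite mulr1; rewrite !mulr1.
Qed.

End Weights.

Section Labelling.
Variables (E : finType) (l : nat).
Implicit Types (S U V : {set E}) (lab : E -> 'I_l.+1) (J : {set 'I_l.+1}).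

Definition part S lab J : {set E} := [set x in S | lab x \in J].

(** A move acts on a family of parts, since that is all the program stores, and takes sets [U] and
    [V] in order to match the values of [elt]. *)
Definition swap (F : {set 'I_l.+1} -> {set E}) U V (j : 'I_l.+1) J : {set E} :=
  F J :\: U :|: (if j \in J then V else set0).

Lemma part_setT S lab : part S lab setT = S.
Proof. by apply/setP => x; rewrite !inE andbT. Qed.

Lemma part_set0 S lab : part S lab set0 = set0.
Proof. by apply/setP => x; rewrite !inE andbF. Qed.

Lemma part_sub S lab J : part S lab J \subset S.
Proof. by apply/subsetP => x; rewrite inE => /andP[]. Qed.

(** The condition on [v] also admits [v = u], a mere relabelling. *)
Lemma swap_part S lab u v j J : v \notin S :\ u ->
  swap (part S lab) [set u] [set v] j J =
  part (v |: S :\ u) (fun x => if x == v then j else lab x) J.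
Proof.
rewrite !inE => vSu; apply/setP => x; rewrite !inE.
have [->|xv] /= := eqVneq x v; last first.
  by case: (j \in J); rewrite !inE ?(negPf xv) orbF andbA.
rewrite andbA (negPf vSu) /=.
by case: (j \in J); rewrite !inE ?eqxx.
Qed.

End Labelling.

(** * Approximate local optima of the potential *)

Section Potential.
Variables (R : realType) (E : finType) (g h : {set E} -> R) (l : nat).
Hypotheses (g_ge0 : nonneg g) (g_mono : monotone g) (g_sub : submodular g).
Hypotheses (h_ge0 : nonneg h) (h_conc : Mnat_concave h).
Implicit Types (S O : {set E}) (J : {set 'I_l.+1}).

Definition potential (F : {set 'I_l.+1} -> {set E}) : R :=
  \sum_(J : {set 'I_l.+1}) (weight l #|J|)%:R * g (F J) +
  (hweight l)%:R * h (F setT).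

Lemma eq_potential F G : F =1 G -> potential F = potential G.
Proof.
by move=> FG; rewrite /potential FG; under eq_bigr do rewrite FG.
Qed.

Lemma potential_ge0 F : 0 <= potential F.
Proof.
by rewrite addr_ge0 ?mulr_ge0 ?sumr_ge0 // => J _; rewrite mulr_ge0.
Qed.

Definition potential_bound : nat :=
  \sum_(J : {set 'I_l.+1}) weight l #|J| + hweight l.

Lemma potential_le S lab :
  potential (part S lab) <= potential_bound%:R * (g S + h S).
Proof.
rewrite /potential /potential_bound natrD mulrDl lerD //.
  rewrite natr_sum mulr_suml ler_sum // => J _.
  rewrite ler_wpM2l // (le_trans (g_mono (part_sub S lab J))) // lerDl.
  exact: h_ge0.
by rewrite part_setT ler_wpM2l // lerDr.
Qed.

(** Submodularity separates the two halves of a move: after deleting [u], inserting [v] gains at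
    least as much as inserting it into the whole part. If [v] is already there, that marginal is
    zero and monotonicity suffices. *)
Lemma swap_gain_ge S lab u v j J : v \notin S :\ u ->
  g (part S lab J :\ u) +
    (if j \in J then g (v |: part S lab J) - g (part S lab J) else 0) <=
  g (swap (part S lab) [set u] [set v] j J).
Proof.
move=> vSu; rewrite /swap; case: ifP => _; last by rewrite setU0 addr0.
have [vJ|vJ] := boolP (v \in part S lab J).
  have -> : v |: part S lab J = part S lab J by apply/setUidPr; rewrite sub1set.
  by rewrite subrr addr0 g_mono // subsetUl.
have := submodular_marginal g_sub (subD1set (part S lab J) u) vJ.
rewrite [_ :\ u :|: _]setUC; lra.
Qed.

(** Sum over the [l.+1] labels [j] of [v]. A label set [J] contains [#|J|] of them, hence the
    coefficient of the insertions; the deletion and [h] terms do not depend on [j]. *)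
Lemma swap_gain_sum S lab W u v : u \in S -> v \notin S :\ u ->
  (forall j, potential (swap (part S lab) [set u] [set v] j) <=
             potential (part S lab) + W) ->
  l.+1%:R * ((hweight l)%:R * (h (v |: S :\ u) - h S)) +
    \sum_(J : {set 'I_l.+1}) (weight l #|J|)%:R * #|J|%:R *
      (g (v |: part S lab J) - g (part S lab J)) <=
  l.+1%:R * (W + \sum_(J : {set 'I_l.+1}) (weight l #|J|)%:R *
      (g (part S lab J) - g (part S lab J :\ u))).
Proof.
move=> uS vSu opt.
pose A J := g (v |: part S lab J) - g (part S lab J).
have swapT j : swap (part S lab) [set u] [set v] j setT = v |: S :\ u.
  by rewrite /swap inE part_setT setUC.
have step j : \sum_(J : {set 'I_l.+1})
      (weight l #|J|)%:R * (if j \in J then A J else 0) <=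
    W + \sum_(J : {set 'I_l.+1}) (weight l #|J|)%:R *
      (g (part S lab J) - g (part S lab J :\ u)) -
    (hweight l)%:R * (h (v |: S :\ u) - h S).
  have := opt j; rewrite /potential swapT part_setT.
  have : \sum_(J : {set 'I_l.+1})
           (weight l #|J|)%:R * (if j \in J then A J else 0) +
         \sum_(J : {set 'I_l.+1}) (weight l #|J|)%:R * g (part S lab J :\ u) <=
         \sum_(J : {set 'I_l.+1}) (weight l #|J|)%:R *
           g (swap (part S lab) [set u] [set v] j J).
    rewrite -big_split ler_sum //= => J _; rewrite -mulrDr ler_wpM2l //.
    by rewrite addrC swap_gain_ge.
  have -> : \sum_(J : {set 'I_l.+1}) (weight l #|J|)%:R *
        (g (part S lab J) - g (part S lab J :\ u)) =
      \sum_(J : {set 'I_l.+1}) (weight l #|J|)%:R * g (part S lab J) -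
      \sum_(J : {set 'I_l.+1}) (weight l #|J|)%:R * g (part S lab J :\ u).
    by rewrite -sumrB; under [RHS]eq_bigr do rewrite -mulrBr.
  lra.
have /(ler_sum (index_enum _)) := fun j (_ : true) => step j.
rewrite sumr_const card_ord exchange_big /= -[X in _ <= X]mulr_natl.
have -> : \sum_(J : {set 'I_l.+1}) \sum_i
            (weight l #|J|)%:R * (if i \in J then A J else 0) =
          \sum_(J : {set 'I_l.+1}) (weight l #|J|)%:R * #|J|%:R * A J.
  apply: eq_bigr => J _; rewrite -big_distrr -big_mkcond /= sumr_const.
  by rewrite -mulrA (mulr_natl (A J)).
rewrite /A; lra.
Qed.

(** Group the elements of [part S lab J] by label: the class of [i] is what [part S lab (J :\ i)]
    lacks, so [submodular_deletion_sum] bounds its losses. Elements outside the part lose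
    nothing. *)
Lemma part_loss_sum S lab :
  \sum_(u in S) \sum_(J : {set 'I_l.+1}) (weight l #|J|)%:R *
      (g (part S lab J) - g (part S lab J :\ u)) <=
  \sum_(J : {set 'I_l.+1}) (weight l #|J|)%:R *
    \sum_(i in J) (g (part S lab J) - g (part S lab (J :\ i))).
Proof.
rewrite exchange_big /= ler_sum // => J _; rewrite -big_distrr /= ler_wpM2l //.
rewrite (bigID [in part S lab J]) /= [X in _ + X]big1 ?addr0; last first.
  move=> u /andP[_ uJ]; suff -> : part S lab J :\ u = part S lab J.
    by rewrite subrr.
  by apply/setDidPl; rewrite disjoint_sym disjoints1.
rewrite (eq_bigl [in part S lab J]) => [|u]; last first.
  by rewrite inE; case: (u \in S).
rewrite (partition_big lab [in J]) /= => [|u]; last by rewrite inE => /andP[].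
apply: ler_sum => i iJ.
have -> : part S lab (J :\ i) =
    part S lab J :\: [set x in part S lab J | lab x == i].
  apply/setP => x; rewrite !inE.
  by case: (x \in S); case: (lab x \in J); rewrite /= ?andbT ?andbF.
rewrite (eq_bigl [in [set x in part S lab J | lab x == i]]) => [|x].
  apply: submodular_deletion_sum => //.
  by apply/subsetP => x; rewrite inE => /andP[].
by rewrite !inE.
Qed.

Lemma part_insertion_sum S O lab :
  \sum_(J : {set 'I_l.+1})
     (weight l #|J|)%:R * #|J|%:R * (g O - g (part S lab J)) <=
  \sum_(v in O) \sum_(J : {set 'I_l.+1}) (weight l #|J|)%:R * #|J|%:R *
      (g (v |: part S lab J) - g (part S lab J)).
Proof.
rewrite [leRHS]exchange_big /= ler_sum // => J _.
rewrite -big_distrr /= ler_wpM2l ?mulr_ge0 //.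
apply: le_trans (submodular_insertion_sum g_sub _ _).
by rewrite lerD2r g_mono // subsetUr.
Qed.

(* The marginals of [g] telescope along [weight_telescope], so that only the
   full set and the empty one survive. *)
Lemma approx_local_optimum S O lab W : #|S| = #|O| ->
  (forall u v j, u \in S -> v \notin S :\ u ->
     potential (swap (part S lab) [set u] [set v] j) <=
     potential (part S lab) + W) ->
  (hweight l)%:R * (g O + h O) - (loss_weight l)%:R * g O <=
  (hweight l)%:R * (g S + h S) + #|S|%:R * W.
Proof.
move=> cSO opt.
pose L u := \sum_(J : {set 'I_l.+1}) (weight l #|J|)%:R *
  (g (part S lab J) - g (part S lab J :\ u)).
pose A v := \sum_(J : {set 'I_l.+1}) (weight l #|J|)%:R * #|J|%:R *
  (g (v |: part S lab J) - g (part S lab J)).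
set c : R := (hweight l)%:R; set d : R := (loss_weight l)%:R.
have c0 : 0 < c by rewrite ltr0n hweight_gt0.
have n0 : 0 < l.+1%:R :> R by rewrite ltr0n.
have scale (n m x y : R) : 0 < n -> 0 < m ->
    n * m * (x / m + - y / (n * m)) = n * x - y.
  by move=> ? ?; field; rewrite !lt0r_neq0.
have gain u v : u \in S -> v \notin S :\ u ->
    l.+1%:R * (c * (h (v |: S :\ u) - h S)) + A v <= l.+1%:R * (W + L u).
  by move=> uS vSu; apply: swap_gain_sum => // j; apply: opt.
have hle : l.+1%:R * (c * (h O - h S)) <=
    \sum_(u in S :\: O) l.+1%:R * (W + L u) - \sum_(v in O :\: S) A v.
  (* Dividing [gain] by [l.+1%:R * c] yields the dual prices for the exchange gains of [h]. *)
  have := Mnat_exchange_bound h_conc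
    (a := fun u => (W + L u) / c) (b := fun v => - A v / (l.+1%:R * c)) cSO.
  rewrite -!mulr_suml sumrN => /(_ _) hle.
  have {hle} /(ler_wpM2l (ltW (mulr_gt0 n0 c0))) : h O - h S <=
      (\sum_(i in S :\: O) (W + L i)) / c +
      - (\sum_(i in O :\: S) A i) / (l.+1%:R * c).
    apply: hle => u v; rewrite !inE => /andP[uO uS] /andP[vS vO].
    have vSu : v \notin S :\ u by rewrite !inE negb_and (negPf vS) orbT.
    have gn := gain _ _ uS vSu; rewrite -(ler_pM2l (mulr_gt0 n0 c0)).
    rewrite scale //.
    lra.
  by rewrite scale // -mulr_sumr mulrA.
(* Elements common to [S] and [O] use the relabelling moves [v = u], which leave [h] unchanged. *)
have common : \sum_(u in S :&: O) A u <= \sum_(u in S :&: O) l.+1%:R * (W + L u).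
  apply: ler_sum => u; rewrite inE => /andP[uS uO].
  have := gain u u uS; rewrite setD11 => /(_ isT).
  by rewrite setD1K // (subrr (h S)) !mulr0 add0r.
have sumS : \sum_(u in S) l.+1%:R * (W + L u) =
    l.+1%:R * (#|S|%:R * W) + l.+1%:R * \sum_(u in S) L u.
  by rewrite -mulr_sumr big_split /= sumr_const mulrDr (mulr_natl W).
have sumL : \sum_(u in S) L u <= _ := part_loss_sum S lab.
have sumA := part_insertion_sum S O lab.
have tele := @weight_telescope l R (fun J => g (part S lab J)).
have tot := weight_total l R.
rewrite (big_setID O) /= in sumS.
have sumO : \sum_(v in O) A v =
    \sum_(v in S :&: O) A v + \sum_(v in O :\: S) A v.
  by rewrite (big_setID S) /= setIC.
have {}sumL := ler_wpM2l (ltW n0) sumL.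
have {}sumA : (\sum_(J : {set 'I_l.+1}) (weight l #|J|)%:R * #|J|%:R) * g O -
    \sum_(J : {set 'I_l.+1}) (weight l #|J|)%:R * #|J|%:R * g (part S lab J) <=
    \sum_(v in O) A v.
  by move: sumA; under eq_bigr do rewrite mulrBr; rewrite sumrB -mulr_suml.
rewrite tot part_setT part_set0 in tele sumA.
rewrite -/c -/d in tele sumA; rewrite -(ler_pM2l n0).
(* The empty-set term of the telescope has the favourable sign and is dropped. *)
have gl0 : 0 <= l.+1%:R * (d * g set0) by rewrite !mulr_ge0.
rewrite sumO in sumA.
lra.
Qed.

End Potential.

(** * The program *)

Section Surely.
Variables (A B : Type).

Lemma surely_impl (P Q : A -> Prop) t :
  (forall a, P a -> Q a) -> surely P t -> surely Q t.
Proof. by move=> PQ; elim: t => [a /PQ|l IHl r IHr [/IHl ? /IHr]]. Qed.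

Lemma surely_bind (P : A -> Prop) (Q : B -> Prop) t k :
  surely P t -> (forall a, P a -> surely Q (k a)) -> surely Q (bind t k).
Proof. by move=> Pt PQ; elim: t Pt => [a /PQ|l IHl r IHr [/IHl ? /IHr]]. Qed.

(** The search tosses no coin and its guarantees hold on every outcome; this carries them over to
    the expectation. *)
Lemma mean_ge (R : realType) (phi : A -> R) m t :
  surely (fun a => m <= phi a) t -> m <= mean phi t.
Proof. by elim: t => //= l IHl r IHr [/IHl ? /IHr ?]; lra. Qed.

End Surely.

(** * Program logic with time bounds *)

Section Hoare.
Variables (R : realType) (E : finType) (g h : {set E} -> R).
Implicit Types (s : state R E) (Q : state R E -> Prop).

(** Stated for a single initial state, so that postconditions can refer to values on entry. *)
Definition hoare B Q c s :=
  surely (fun s' => Q s' /\ (time s' <= time s + B)%N) (exec g h c s).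

Lemma hoare_weaken B B' Q Q' c s : (B <= B')%N -> (forall s', Q s' -> Q' s') ->
  hoare B Q c s -> hoare B' Q' c s.
Proof. by move=> leB QQ; apply: surely_impl => s' [/QQ ? ?]; split=> //; lia. Qed.

Lemma hoare_seq B1 B2 B Q1 Q c1 c2 s : (B1 + B2 <= B)%N -> hoare B1 Q1 c1 s ->
  (forall s', Q1 s' -> hoare B2 Q c2 s') -> hoare B Q (Seq c1 c2) s.
Proof.
move=> leB H1 H2; apply: surely_bind H1 _ => s' [/H2 H t1].
by apply: surely_impl H => s'' [? ?]; split=> //; lia.
Qed.

Lemma hoare_if B Q b c1 c2 s :
  (beval g h s b -> hoare B Q c1 (tick s)) ->
  (~~ beval g h s b -> hoare B Q c2 (tick s)) -> hoare B.+1 Q (If b c1 c2) s.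
Proof.
rewrite /hoare /=; case: ifP => _ => [/(_ isT)+ _|_ /(_ isT)];
  by apply: surely_impl => s' /= [? ?]; split=> //; lia.
Qed.

(** The two successors pay for the tick of each iteration and the tick of the loop entry. *)
Lemma hoare_for B (I : nat -> state R E -> Prop) a e c s :
  I 0 (tick s) ->
  (forall i s', (i < neval s e)%N -> I i s' ->
     hoare B (I i.+1) c (tick (set_n s' a 0 i))) ->
  hoare (neval s e * B.+1).+1 (I (neval s e)) (For a e c) s.
Proof.
move=> I0 step; rewrite /hoare /=.
have loopP m i s' : (i + m = neval s e)%N -> I i s' ->
    surely (fun s'' => I (neval s e) s'' /\
              (time s'' <= time s' + m * B.+1)%N)
      (loop (fun i s' => exec g h c (tick (set_n s' a 0 i))) m i s').
  elim: m i s' => [|m IHm] i s' /=.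
    by rewrite addn0 => <-; rewrite mul0n addn0.
  move=> im Ii; have im' : (i < neval s e)%N by lia.
  apply: surely_bind (step _ _ im' Ii) _ => s1 [I1 /= t1].
  apply: surely_impl (IHm i.+1 s1 _ I1); last lia.
  by move=> s2 [? ?]; split=> //; rewrite mulSn; lia.
by apply: surely_impl (loopP _ 0 _ _ I0) => // s' /= [? ?]; split=> //; lia.
Qed.

Lemma hoare_sset a i e s :
  hoare 1 (fun s' => s' = tick (set_s s a (neval s i) (seval s e))) (SSet a i e) s.
Proof. by split=> //=; rewrite addn1. Qed.

End Hoare.

(* The real memory is not used, so that writing to it does nothing. *)
Definition skip : cmd := RSet 0 (NLit 0) (RLit 0).

Definition seq_all (T : Type) (c : T -> cmd) (r : seq T) : cmd :=
  foldr (fun x => Seq (c x)) skip r.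

(** The machine has no product, so multiplication by a constant of the program is unrolled into
    additions. *)
Definition nscale (n : nat) (e : nexp) : nexp := iter n (NAdd e) (NLit 0).
Definition rscale (n : nat) (e : rexp) : rexp := iter n (RAdd e) (RLit 0).

Section Program.
Variables (l rounds : nat).

(* Set expressions have no unions, so the program keeps all the parts [S_J] of
   the current solution, and of the best neighbour found so far, in memory. *)
Definition idx (J : {set 'I_l.+1}) : nat := enum_rank J.

Lemma idx_inj : injective idx.
Proof. by move=> I J /val_inj/enum_rank_inj. Qed.

Definition ground_size : nexp := NGet 0 (NLit 0).
Definition current (J : {set 'I_l.+1}) : sexp := SGet 1 (NLit (idx J)).
Definition best (J : {set 'I_l.+1}) : sexp := SGet 2 (NLit (idx J)).
Definition uvar : nexp := NGet 4 (NLit 0).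
Definition vvar : nexp := NGet 5 (NLit 0).

Definition swapped (j : 'I_l.+1) (J : {set 'I_l.+1}) : sexp :=
  let e := SDel (current J) uvar in if j \in J then SIns e vvar else e.

Definition potential_expr (F : {set 'I_l.+1} -> sexp) : rexp :=
  RAdd (foldr (fun J : {set 'I_l.+1} =>
                 RAdd (rscale (weight l #|J|) (ROracleG (F J))))
          (RLit 0) (enum {: {set 'I_l.+1}}))
       (rscale (hweight l) (ROracleH (F setT))).

Definition value_expr (e : sexp) : rexp := RAdd (ROracleG e) (ROracleH e).

Definition set_family (a : nat) (F : {set 'I_l.+1} -> sexp) : cmd :=
  seq_all (fun J => SSet a (NLit (idx J)) (F J)) (enum {: {set 'I_l.+1}}).

Definition swap_test (j : 'I_l.+1) : bexp :=
  BAnd (BMem uvar (current setT))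
    (BAnd (BNot (BMem vvar (SDel (current setT) uvar)))
          (BLeR (potential_expr best) (potential_expr (swapped j)))).

Definition try_swap (j : 'I_l.+1) : cmd :=
  If (swap_test j) (set_family 2 (swapped j)) skip.

Definition find_best : cmd :=
  For 4 ground_size (For 5 ground_size (seq_all try_swap (enum 'I_l.+1))).

Definition record : cmd :=
  If (BLeR (value_expr (SGet 0 (NLit 0))) (value_expr (current setT)))
    (SSet 0 (NLit 0) (current setT)) skip.

Definition round : cmd :=
  Seq (set_family 2 current) (Seq find_best (Seq (set_family 1 best) record)).

Definition grow (J : {set 'I_l.+1}) : sexp :=
  if ord0 \in J then SIns (current J) (NGet 3 (NLit 0)) else current J.

(* [n - (n - k)] is [minn k n]. *)
Definition initialize : cmd :=
  Seq (For 3 (NSub ground_size (NSub ground_size (NGet 1 (NLit 0))))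
         (Seq (set_family 2 grow) (set_family 1 best)))
      (SSet 0 (NLit 0) (current setT)).

(** Counting [n + 1] rather than [n] in the number of rounds makes the final comparison of
    potentials strict, also when [n] is 0. *)
Definition local_search : cmd :=
  Seq initialize (For 3 (nscale rounds (NAdd ground_size (NLit 1))) round).

End Program.

(** * Correctness and running time of the local search *)

Section Correctness.
Variables (R : realType) (E : finType) (g h : {set E} -> R) (l rounds : nat).
Hypotheses (g_ge0 : nonneg g) (g_mono : monotone g) (g_sub : submodular g).
Hypotheses (h_ge0 : nonneg h) (h_conc : Mnat_concave h).
Variables (k : nat).
Let n := #|E|.
Let K := minn k n.
Implicit Types (s : state R E) (J : {set 'I_l.+1}) (F : {set 'I_l.+1} -> {set E}).
Local Notation N := #|{: {set 'I_l.+1}}|.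
Local Notation hoare := (hoare g h).
Local Notation pot := (potential g h (l := l)).
Local Notation f := (fun X => g X + h X).

Definition family a s J : {set E} := smem s a (idx J).

Lemma elt_enum_rank (x : E) : elt E (enum_rank x) = [set x].
Proof.
apply/setP => y; rewrite !inE; apply/eqP/eqP => [/val_inj/enum_rank_inj//|->//].
Qed.

Lemma mem_elt (x : E) (S : {set E}) : ([set x] :&: S != set0) = (x \in S).
Proof. by rewrite setI_eq0 disjoints1 negbK. Qed.

Lemma enum_rank_ltn i : (i < n)%N -> exists x : E, i = enum_rank x.
Proof. by move=> lti; exists (enum_val (Ordinal lti)); rewrite enum_valK. Qed.

Lemma reval_rscale s m e : reval g h s (rscale m e) = m%:R * reval g h s e.
Proof.
elim: m => [|m IHm]; first by rewrite mul0r.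
by rewrite [LHS]/= -/(rscale m e) IHm -addn1 natrD mulrDl mul1r addrC.
Qed.

Lemma neval_nscale s m e : neval s (nscale m e) = (m * neval s e)%N.
Proof. by elim: m => //= m IHm; rewrite -/(nscale m e) IHm mulSn. Qed.

Lemma reval_potential s (F : {set 'I_l.+1} -> sexp) :
  reval g h s (potential_expr F) = pot (fun J => seval s (F J)).
Proof.
rewrite /potential_expr [LHS]/= reval_rscale /potential -big_enum.
congr (_ + _); elim: (enum _) => [|J r IHr]; first by rewrite big_nil.
by rewrite big_cons /= IHr reval_rscale.
Qed.

Lemma beval_swap_test s x y j :
  nmem s 4 0 = enum_rank x -> nmem s 5 0 = enum_rank y ->
  beval g h s (swap_test j) =
  [&& x \in family 1 s setT, y \notin family 1 s setT :\ x &
      pot (family 2 s) <= pot (swap (family 1 s) [set x] [set y] j)].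
Proof.
move=> s4 s5; rewrite -(mem_elt x) -(mem_elt y) -!elt_enum_rank -s4 -s5.
rewrite -(eq_potential g h (F := fun J => seval s (swapped j J))
  (G := swap (family 1 s) (elt E (nmem s 4 0)) (elt E (nmem s 5 0)) j)).
  rewrite -reval_potential.
  suff -> : pot (family 2 s) = reval g h s (potential_expr (@best l)) by [].
  by rewrite reval_potential.
by move=> J; rewrite /swapped /swap; case: ifP => _ //=; rewrite setU0.
Qed.

Lemma hoare_skip s :
  hoare 1 (fun s' => nmem s' = nmem s /\ smem s' = smem s) skip s.
Proof. by split=> //=; rewrite addn1. Qed.

(** The sets are written one by one, so [F] must not read the array [b] being overwritten; hence the
    detour through array 2 in every update of array 1. *)
Lemma hoare_set_family b (F : {set 'I_l.+1} -> sexp) s :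
  (forall J s', nmem s' = nmem s ->
     (forall a i, a != b -> smem s' a i = smem s a i) ->
     seval s' (F J) = seval s (F J)) ->
  hoare N.+1 (fun s' => [/\ nmem s' = nmem s,
      forall a i, a != b -> smem s' a i = smem s a i &
      family b s' =1 fun J => seval s (F J)]) (set_family b F) s.
Proof.
move=> indep; rewrite /set_family cardE.
suff H r s1 : nmem s1 = nmem s ->
    (forall a i, a != b -> smem s1 a i = smem s a i) ->
    hoare (size r).+1 (fun s' => [/\ nmem s' = nmem s,
      forall a i, a != b -> smem s' a i = smem s a i &
      forall J, family b s' J = if J \in r then seval s (F J)
                                else family b s1 J])
      (seq_all (fun J => SSet b (NLit (idx J)) (F J)) r) s1.
  apply: hoare_weaken (leqnn _) _ (H (enum _) s erefl (fun _ _ _ => erefl)).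
  by move=> s' [? ? H']; split=> // J; rewrite H' mem_enum.
elim: r s1 => [|J r IHr] s1 ns1 ss1 /=.
  apply: hoare_weaken (leqnn _) _ (hoare_skip s1) => s' [nE sE].
  by rewrite nE /family sE.
apply: (hoare_seq (B2 := (size r).+1) _ (hoare_sset g h b _ _ s1)) => // _ ->.
set s2 := tick _.
apply: hoare_weaken (leqnn _) _ (IHr s2 _ _) => //=.
  move=> s' [? ? H]; split=> // J'; rewrite H inE /family /= /upd eqxx /=.
  have [->|J'J] := eqVneq J' J; first by rewrite eqxx indep // if_same.
  by case: ifP => // _; case: eqP => // /idx_inj /eqP; rewrite (negPf J'J).
by move=> a i ab; rewrite /upd (negPf ab) /= ss1.
Qed.

(** The labelling is a ghost: memory holds only the parts, and the proof carries some labelling that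
    explains them. *)
Definition labelled F :=
  exists (S : {set E}) (lab : E -> 'I_l.+1), #|S| = K /\ F =1 part S lab.

Lemma labelled_ext F F' : F =1 F' -> labelled F -> labelled F'.
Proof.
by move=> FF' [S [lab [cS FE]]]; exists S, lab; split=> // J; rewrite -FF'.
Qed.

Lemma labelled_card F : labelled F -> #|F setT| = K.
Proof. by case=> S [lab [cS FE]]; rewrite FE part_setT. Qed.

Lemma labelled_swap F u v j : labelled F -> u \in F setT -> v \notin F setT :\ u ->
  labelled (swap F [set u] [set v] j).
Proof.
case=> S [lab [cS FE]]; rewrite FE part_setT => uS vSu.
exists (v |: S :\ u), (fun x => if x == v then j else lab x); split.
  by rewrite cardsU1 vSu -cS (cardsD1 u S) uS.
by move=> J; rewrite -swap_part // /swap FE.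
Qed.

Definition env s := nmem s 0 0 = n /\ nmem s 1 0 = k.

Section Round.
Variables (F0 : {set 'I_l.+1} -> {set E}) (out0 : {set E}).
Hypothesis F0l : labelled F0.

(** [D] is the set of moves tried so far, which grows along the nested loops. *)
Definition searched (D : E -> E -> 'I_l.+1 -> Prop) s :=
  [/\ env s, family 1 s =1 F0, output s = out0, labelled (family 2 s) &
   forall u v j, D u v j -> u \in F0 setT -> v \notin F0 setT :\ u ->
     pot (swap F0 [set u] [set v] j) <= pot (family 2 s)].

Lemma searched_impl (D D' : E -> E -> 'I_l.+1 -> Prop) s :
  (forall u v j, D' u v j -> D u v j) -> searched D s -> searched D' s.
Proof. by move=> DD [? ? ? ? H]; split=> // u v j /DD; apply: H. Qed.

Lemma hoare_try_swap D s x y j : searched D s ->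
  nmem s 4 0 = enum_rank x -> nmem s 5 0 = enum_rank y ->
  hoare N.+2 (fun s' =>
      searched (fun u v i => D u v i \/ [/\ u = x, v = y & i = j]) s' /\
      nmem s' = nmem s)
    (try_swap j) s.
Proof.
move=> [envs F1 outs lab2 sD] s4 s5.
have swapE : swap (family 1 s) [set x] [set y] j =1 swap F0 [set x] [set y] j.
  by move=> J; rewrite /swap F1.
apply: hoare_if; rewrite (beval_swap_test _ s4 s5) F1 (eq_potential g h swapE).
  case/and3P => xF yF le.
  apply: hoare_weaken (leqnn _) _ (hoare_set_family _) => [s' [nE sE fE]|]; last first.
    move=> J s' nE sE; rewrite /swapped; case: ifP => _ /=;
      by rewrite nE sE.
  split=> //; have fE' : family 2 s' =1 swap F0 [set x] [set y] j.
    move=> J; rewrite fE -swapE /swapped /swap /family /=.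
    by case: ifP => _ /=; rewrite ?setU0 s4 ?s5 !elt_enum_rank.
  split; rewrite /env ?nE //.
  - by move=> J; rewrite /family sE //; apply: F1.
  - by rewrite /output sE.
  - by apply: labelled_ext (labelled_swap j F0l xF yF) => J; rewrite fE'.
  - move=> u v i; rewrite (eq_potential g h fE').
    case=> [Duvi uF vF|[-> -> ->] //].
    exact: le_trans (sD _ _ _ Duvi uF vF) le.
move=> nle; apply: hoare_weaken (hoare_skip _) => // s' /= [nE sE]; split=> //.
have fE a J : family a s' J = family a s J by rewrite /family sE.
split; rewrite /env ?nE /output ?sE //.
- by move=> J; rewrite fE F1.
- by apply: labelled_ext lab2 => J; rewrite fE.
move=> u v i; rewrite (eq_potential g h (fE 2)).
case=> [|[-> -> ->] xF yF]; first exact: sD.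
by move: nle; rewrite xF yF /= -ltNge => /ltW.
Qed.

Lemma hoare_try_swaps D s x y : searched D s ->
  nmem s 4 0 = enum_rank x -> nmem s 5 0 = enum_rank y ->
  hoare (l.+1 * N.+2).+1 (fun s' =>
      searched (fun u v i => D u v i \/ u = x /\ v = y) s' /\ nmem s' = nmem s)
    (seq_all (@try_swap l) (enum 'I_l.+1)) s.
Proof.
move=> sD s4 s5; rewrite -[X in (X * _)%N](card_ord l.+1) cardE.
suff H r s1 (D1 : E -> E -> 'I_l.+1 -> Prop) : searched D1 s1 -> nmem s1 = nmem s ->
    hoare (size r * N.+2).+1 (fun s' =>
        searched (fun u v i => D1 u v i \/ [/\ u = x, v = y & i \in r]) s' /\
        nmem s' = nmem s)
      (seq_all (@try_swap l) r) s1.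
  apply: hoare_weaken (leqnn _) _ (H (enum _) s D sD erefl) => s' [sD' ?].
  split=> //; apply: searched_impl sD' => u v i [?|[? ?]]; first by left.
  by right; rewrite mem_enum.
elim: r s1 D1 => [|j r IHr] s1 D1 sD1 ns1.
  apply: hoare_weaken (hoare_skip s1) => // s' [nE sE]; rewrite nE.
  split=> //; case: sD1 => envs F1 outs lab2 H.
  have fE a J : family a s' J = family a s1 J by rewrite /family sE.
  split; rewrite /env ?nE /output ?sE //.
  - by move=> J; rewrite fE F1.
  - by apply: labelled_ext lab2 => J; rewrite fE.
  - by move=> u v i; rewrite (eq_potential g h (fE 2)) => -[|[]//]; apply: H.
rewrite [seq_all _ _]/=.
have H1 := hoare_try_swap j sD1; rewrite ns1 in H1.
apply: (hoare_seq (B2 := (size r * N.+2).+1) _ (H1 _ _ s4 s5)) => [|s2 [sD2 ns2]].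
  by rewrite mulSn addnS.
 apply: hoare_weaken (leqnn _) _ (IHr s2 _ sD2 ns2).
move=> s' [sD' ?]; split=> //; apply: searched_impl sD' => u v i.
rewrite inE => -[?|[-> -> /predU1P[->|?]]]; first by do 2 left.
  by left; right.
by right.
Qed.

Definition find_best_time := (n * (n * (l.+1 * N.+2).+2).+2).+1.

Lemma hoare_find_best s : searched (fun _ _ _ => False) s ->
  hoare find_best_time (searched (fun _ _ _ => True)) (find_best l) s.
Proof.
move=> s0; have [[ns0 _] _ _ _ _] := s0.
have nE s1 : env s1 -> neval s1 ground_size = n by case.
(* The pairs are tried in lexicographic order: [Du] covers the completed values of [u], and [Dv]
   adds the completed values of [v] for the current [u]. *)
pose Du i (u v : E) (_ : 'I_l.+1) := (enum_rank u < i)%N.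
have := @hoare_for R E g h (n * (l.+1 * N.+2).+2).+1 (fun i => searched (Du i)) 4
  ground_size (For 5 ground_size (seq_all (@try_swap l) (enum 'I_l.+1))) s.
rewrite nE; last by case: s0.
move=> H; apply: hoare_weaken (H _ _).
- by [].
- by move=> s'; apply: searched_impl => u v j _; rewrite /Du ltn_ord.
- case: s0 => ? ? ? ? _; split=> //.
move=> i s1 /enum_rank_ltn[x ->] {H} [envs1 F1 out1 lab1 H1].
set s2 := tick _.
pose Dv i' u v (j : 'I_l.+1) :=
  Du (enum_rank x) u v j \/ u = x /\ (enum_rank v < i')%N.
have := @hoare_for R E g h (l.+1 * N.+2).+1
  (fun i s => searched (Dv i) s /\ nmem s 4 0 = enum_rank x) 5
  ground_size (seq_all (@try_swap l) (enum 'I_l.+1)) s2.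
rewrite nE; last by case: envs1.
move=> H; apply: hoare_weaken (H _ _).
- by [].
- move=> s' [+ _]; apply: searched_impl => u v j.
  rewrite /Du /Dv ltnS leq_eqVlt => /orP[/eqP/val_inj/enum_rank_inj ->|]; last by left.
  by right.
- by split=> //; split=> // u v j [|[]//]; apply: H1.
move=> i' s3 /enum_rank_ltn[y ->] {H} [sD s34].
apply: hoare_weaken (hoare_try_swaps (x := x) (y := y) (D := Dv (enum_rank y)) _ _ _).
- by [].
- move=> s' [sD' nE']; split; last by rewrite nE' /=.
  apply: searched_impl sD' => u v j; rewrite /Dv ltnS leq_eqVlt.
  case=> [|[-> /orP[/eqP/val_inj/enum_rank_inj ->|]]]; first by do 2 left.
    by right.
  by left; right.
- case: sD => ? ? ? ? ?; split=> //.
- exact: s34.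
- by [].
Qed.

End Round.

Definition round_time := (N.+1 + (find_best_time + (N.+1 + 2)))%N.

Definition valid s :=
  [/\ env s, labelled (family 1 s), #|output s| = K &
      f (family 1 s setT) <= f (output s)].

Lemma hoare_copy_best s :
  hoare N.+1 (fun s' => [/\ nmem s' = nmem s, output s' = output s &
      family 1 s' =1 family 2 s]) (set_family 1 (@best l)) s.
Proof.
apply: hoare_weaken (leqnn _) _ (hoare_set_family _) => [s' [nE sE fE]|].
  by split=> //; rewrite /output sE.
by move=> J s' _ sE; rewrite /= sE.
Qed.

Lemma hoare_record s : env s -> labelled (family 1 s) -> #|output s| = K ->
  hoare 2 (fun s' => [/\ valid s', f (output s) <= f (output s') &
                         family 1 s' =1 family 1 s]) (record l) s.
Proof.
move=> envs lab1 outK.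
apply: hoare_if => le.
  apply: hoare_weaken (hoare_sset g h _ _ _ _) => // s' ->.
  have outE : output (tick (set_s (tick s) 0 0 (family 1 s setT))) =
    family 1 s setT by [].
  split=> //; split=> //; rewrite outE ?lexx //; exact: labelled_card.
apply: hoare_weaken (hoare_skip _) => // s' [nE sE].
have fE : family 1 s' =1 family 1 s by move=> J; rewrite /family sE.
have outE : output s' = output s by rewrite /output sE.
split; rewrite ?outE // /valid /env nE outE fE; split=> //.
  by apply: labelled_ext lab1 => J; rewrite fE.
by move: le; rewrite -ltNge => /ltW.
Qed.

(** The last clause feeds [labelled_local_optimum], with the new potential as [P]. *)
Lemma hoare_round s : valid s ->
  hoare round_time (fun s' => [/\ valid s', f (output s) <= f (output s') &
      forall u v j, u \in family 1 s setT -> v \notin family 1 s setT :\ u ->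
        pot (swap (family 1 s) [set u] [set v] j) <= pot (family 1 s')])
    (round l) s.
Proof.
move=> [envs lab1 outK le]; set F0 := family 1 s.
apply: (hoare_seq (leqnn _) (Q1 := searched F0 (output s) (fun _ _ _ => False))).
  apply: hoare_weaken (leqnn _) _ (hoare_set_family _) => [s' [nE sE fE]|].
    split; rewrite /env ?nE /output ?sE //; last by apply: labelled_ext lab1.
    by move=> J; rewrite /family sE.
  by move=> J s' _ sE; rewrite /= sE.
move=> s1 s1P.
apply: (hoare_seq (leqnn _) (hoare_find_best lab1 s1P)).
move=> s2 [envs2 F2 out2 lab2 opt].
apply: (hoare_seq (leqnn _) (hoare_copy_best s2)).
move=> s3 [nE oE fE].
have lab3 : labelled (family 1 s3) by apply: labelled_ext lab2 => J; rewrite fE.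
apply: hoare_weaken (leqnn _) _ (hoare_record _ lab3 _) => [s4 [vs4 le4 f4]||].
- split=> //; first by rewrite -out2 -oE.
  move=> u v j uF vF; have f42 : family 1 s4 =1 family 2 s2.
    by move=> J; rewrite f4 fE.
  by rewrite (eq_potential g h f42); apply: opt.
- by rewrite /env nE.
- by rewrite oE out2.
Qed.

Lemma card_prefix i : (i <= n)%N -> #|[set x : E | (enum_rank x < i)%N]| = i.
Proof.
elim: i => [_|i IHi lti]; first by apply: eq_card0 => x; rewrite inE.
have [x xi] := enum_rank_ltn lti.
have -> : [set y : E | (enum_rank y < i.+1)%N] =
    x |: [set y : E | (enum_rank y < i)%N].
  apply/setP => y; rewrite !inE ltnS leq_eqVlt xi.
  by rewrite (inj_eq val_inj) (inj_eq enum_rank_inj).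
by rewrite cardsU1 inE -xi ltnn IHi // ltnW.
Qed.

Definition init_time := ((n * (N.+1 + N.+1).+1).+1 + 1)%N.

Lemma hoare_initialize :
  hoare init_time valid (initialize l) (init R E k).
Proof.
pose S i := [set x : E | (enum_rank x < i)%N].
pose I i s := env s /\ family 1 s =1 part (S i) (fun=> ord0).
have KE : neval (init R E k)
    (NSub ground_size (NSub ground_size (NGet 1 (NLit 0)))) = K.
  by rewrite /= /upd /= /K -/n; lia.
apply: (hoare_seq (leqnn _) (Q1 := I K)).
  rewrite -{1}KE.
  apply: hoare_weaken (hoare_for (B := (N.+1 + N.+1)%N) (I := I) _ _) => //.
  - by rewrite KE ltnS leq_mul2r geq_minr orbT.
  - split; first by split.
    by move=> J; apply/setP => x; rewrite !inE.
  rewrite KE => i s iK [envs fE]; set s0 := tick _.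
  apply: (hoare_seq (leqnn _) (Q1 := fun s1 => env s1 /\
      family 2 s1 =1 part (S i.+1) (fun=> ord0))).
    apply: hoare_weaken (leqnn _) _ (hoare_set_family _) => [s1 [nE sE gE]|]; last first.
      by move=> J s1 nE sE; rewrite /grow; case: ifP => _ /=; rewrite ?nE sE.
    split; first by rewrite /env nE; case: envs.
    have [x xi] := enum_rank_ltn (leq_trans iK (geq_minr _ _)).
    have s03 : nmem s0 3 0 = enum_rank x by rewrite -xi.
    move=> J; rewrite gE /grow; case: ifP => J0.
      rewrite -[LHS]/(family 1 s J :|: elt E (nmem s0 3 0)) fE s03 elt_enum_rank.
      apply/setP => y; rewrite !inE J0 !andbT xi [RHS]ltnS [RHS]leq_eqVlt orbC.
      by rewrite (inj_eq val_inj) (inj_eq enum_rank_inj).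
    rewrite -[LHS]/(family 1 s J) fE.
    by apply/setP => y; rewrite !inE J0 !andbF.
  move=> s1 [envs1 fE1].
  apply: hoare_weaken (leqnn _) _ (hoare_copy_best s1) => s2 [nE _ fE2].
  by split; [rewrite /env nE|move=> J; rewrite fE2].
move=> s1 [envs1 fE1]; apply: hoare_weaken (hoare_sset g h _ _ _ _) => // s2 ->.
have lab : labelled (family 1 s1).
  by exists (S K), (fun=> ord0); split=> //; apply: card_prefix; apply: geq_minr.
have outE : output (tick (set_s s1 0 0 (family 1 s1 setT))) = family 1 s1 setT by [].
split=> //; rewrite outE //; exact: labelled_card.
Qed.

(** The slack in [approx_local_optimum] is taken to be the gain [P - pot F] of a round, so a
    solution far below the target forces a large gain. *)
Lemma labelled_local_optimum F (O : {set E}) P : labelled F -> #|O| = K ->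
  (forall u v j, u \in F setT -> v \notin F setT :\ u ->
     pot (swap F [set u] [set v] j) <= P) ->
  (hweight l)%:R * f O - (loss_weight l)%:R * g O <=
  (hweight l)%:R * f (F setT) + K%:R * (P - pot F).
Proof.
case=> S [lab [cS FE]] cO opt; rewrite FE part_setT -cS.
have potE := eq_potential g h FE; rewrite potE.
apply: (approx_local_optimum g_ge0 g_mono g_sub h_conc (lab := lab)).
  by rewrite cS.
move=> u v j uS vS.
have := opt u v j; rewrite FE part_setT => /(_ uS vS).
rewrite addrC subrK; congr (_ <= _); apply: eq_potential => J.
by rewrite /swap FE.
Qed.

Definition search_time :=
  (init_time + (rounds * n.+1 * round_time.+1).+1)%N.

Lemma hoare_local_search (delta : R) : 0 < delta -> (0 < rounds)%N ->
  (potential_bound l)%:R <= rounds%:R * delta ->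
  hoare search_time (fun s => #|output s| = K /\
    forall O : {set E}, #|O| = K ->
      (forall X : {set E}, #|X| = K -> f X <= f O) ->
      (hweight l)%:R * f O - (loss_weight l)%:R * g O - delta * f O <=
      (hweight l)%:R * f (output s))
    (local_search l rounds) (init R E k).
Proof.
move=> delta0 rounds0 leb.
apply: (hoare_seq (leqnn _) hoare_initialize) => s vs.
pose good O s := (hweight l)%:R * f O - (loss_weight l)%:R * g O - delta * f O <=
      (hweight l)%:R * f (output s).
(* The potential is [O(f O)], so that its linear growth cannot last. *)
pose I t s := valid s /\ forall O : {set E}, #|O| = K ->
  (forall X : {set E}, #|X| = K -> f X <= f O) ->
  good O s \/ t%:R * (delta * f O) <= K%:R * pot (family 1 s).
have tE : neval s (nscale rounds (NAdd ground_size (NLit 1))) = (rounds * n.+1)%N.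
  by rewrite neval_nscale /=; case: vs => -[-> _] _ _ _; rewrite addn1.
have c0 : 0 < (hweight l)%:R :> R by rewrite ltr0n hweight_gt0.
have f_ge0 X : 0 <= f X by rewrite addr_ge0.
rewrite -tE; apply: hoare_weaken (hoare_for (B := round_time) (I := I) _ _) => //.
- move=> s' [[_ [S [lab [cS FE]]] outK _] H]; split=> // O cO Omax.
  case: (H O cO Omax) => //; rewrite tE (eq_potential g h FE) => ineq.
  have potle := potential_le g_ge0 g_mono h_ge0 S lab.
  have fSO := Omax S cS.
  (* When [f O] is 0 nothing grows, but the target is nonpositive. *)
  have [fO0|fO0] := eqVneq (f O) 0.
    rewrite fO0 !mulr0 subr0 sub0r.
    by apply: (@le_trans _ _ 0); rewrite ?oppr_le0 ?mulr_ge0.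
  have fO : 0 < f O by rewrite lt_neqAle eq_sym fO0 f_ge0.
  suff : (rounds * n.+1)%:R * (delta * f O) < (rounds * n.+1)%:R * (delta * f O).
    by rewrite ltxx.
  apply: le_lt_trans ineq _.
  apply: (@le_lt_trans _ _ (n%:R * ((potential_bound l)%:R * f O))).
    apply: ler_pM => //; first exact: potential_ge0.
      by rewrite ler_nat geq_minr.
    by apply: le_trans potle _; rewrite ler_wpM2l.
  apply: (@le_lt_trans _ _ (n%:R * (rounds%:R * delta * f O))).
    by rewrite ler_wpM2l // ler_wpM2r // ltW.
  rewrite -!mulrA mulrA -natrM ltr_pM2r ?mulr_gt0 // ltr_nat.
  by rewrite mulnC ltn_pmul2l.
- split=> // O cO Omax; right; rewrite mul0r mulr_ge0 //; exact: potential_ge0.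
move=> t s1 _ [vs1 H]; set s2 := tick _.
have vs2 : valid s2 by case: vs1 => ? ? ? ?; split.
apply: hoare_weaken (leqnn _) _ (hoare_round vs2) => s3 [vs3 le3 opt].
split=> // O cO Omax; have [[_ lab1 _ le1] _] := (vs1, vs3).
have [good3|bad3] := boolP
  ((hweight l)%:R * f O - (loss_weight l)%:R * g O - delta * f O <=
   (hweight l)%:R * f (output s3)); first by left.
right; rewrite -ltNge in bad3.
case: (H O cO Omax) => [good1|ineq].
  have le13 : f (output s1) <= f (output s3) by [].
  have := ler_wpM2l (ltW c0) le13; rewrite /good in good1; lra.
(* The old solution misses the local optimality bound by more than [delta * f O], so [K] times the
   potential has grown by at least that much. *)
have := labelled_local_optimum lab1 cO opt.
have le13 : f (family 1 s1 setT) <= f (output s3) by apply: le_trans le1 le3.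
have := ler_wpM2l (ltW c0) le13.
rewrite -natr1 mulrDl mul1r; lra.
Qed.

End Correctness.

(** * Padding the optimum, the time polynomial, the curvature and the final bound *)

Lemma superset_of_card (E : finType) (O : {set E}) m : (#|O| <= m <= #|E|)%N ->
  exists2 O' : {set E}, O \subset O' & #|O'| = m.
Proof.
elim: m => [|m IHm] /andP[Om mE].
  by exists O => //; apply/eqP; rewrite -leqn0.
move: Om; rewrite leq_eqVlt => /orP[/eqP <-|Om]; first by exists O.
have [|O' OO' cO'] := IHm; first by rewrite -ltnS Om ltnW.
have /subsetPn[x _ xO'] : ~~ ([set: E] \subset O').
  by apply/negP => /subset_leq_card; rewrite cardsT cO' leqNgt mE.
exists (x |: O'); first by rewrite (subset_trans OO') // subsetUr.
by rewrite cardsU1 xO' cO'.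
Qed.

Definition time_poly (l rounds : nat) : {poly nat} :=
  let N := #|{: {set 'I_l.+1}}| in
  let find := 'X * ('X * (l.+1 * N.+2).+2%:P + 2%:P) + 1 in
  ('X * (N.+1 + N.+1).+1%:P + 2%:P) +
  (rounds%:P * ('X + 1) * (N.+1%:P + (find + (N.+1 + 2)%:P) + 1) + 1).

Lemma time_polyE (E : finType) l rounds :
  (time_poly l rounds).[#|E|] = search_time E l rounds.
Proof.
rewrite /time_poly /search_time /round_time /find_best_time /init_time.
rewrite !hornerE /=.
lia.
Qed.

(** The ratio at [O] is finite and all ratios are nonnegative, so the minimum is a real number
    despite the convention for 0/0. *)
Lemma curvature_le (R : realType) (E : finType) (f h : {set E} -> R) (O : {set E}) :
  nonneg f -> nonneg h -> 0 < f O ->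
  exists2 r : R, h_curvature f h = (1 - r)%:E & r * f O <= h O.
Proof.
move=> f0 h0 fO; rewrite /h_curvature.
set m := \big[_/_]_X _.
have mle : (m <= (h O / f O)%:E)%E.
  by apply: le_trans (bigmin_le _ O _) _; rewrite /curv_ratio gt_eqF.
have m0 : (0%:E <= m)%E.
  apply: le_bigmin => [|X _]; first by rewrite leey.
  by rewrite /curv_ratio; case: eqP => _; rewrite ?leey // lee_fin divr_ge0.
case: m mle m0 => [r| |] //; rewrite lee_fin => rle _; exists r => //.
by rewrite -ler_pdivlMr.
Qed.

Theorem theorem1 (R : realType) (eps : R) (eps_gt0 : 0 < eps) :
  exists (alg : cmd) (p : {poly nat}),
    forall (E : finType) (f g h : {set E} -> R) (k : nat),
      nonneg f -> monotone f -> submodular f ->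
      nonneg g -> monotone g -> submodular g ->
      nonneg h -> Mnat_concave h ->
      (forall X : {set E}, f X = g X + h X) ->
      surely (fun s => (time s <= p.[#|E|])%N /\ #|output s| = minn k #|E|)
             (run g h alg k) /\
      forall O : {set E}, optimal f k O ->
        ((1 - h_curvature f h * ((expR 1)^-1)%:E - eps%:E) * (f O)%:E
           <= (mean (fun s => f (output s)) (run g h alg k))%:E)%E.
Proof.
(* Half of [eps] absorbs the excess 1/(l+1) over 1/e, the other half the slack [delta] of the
   search. *)
pose l := Num.bound (2 / eps).
pose c : R := (hweight l)%:R.
have c0 : 0 < c by rewrite ltr0n hweight_gt0.
pose delta := c * (eps / 2).
have delta0 : 0 < delta by rewrite mulr_gt0 // divr_gt0.
pose rounds := (Num.bound ((potential_bound l)%:R / delta)).+1.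
have lle : l.+1%:R^-1 <= eps / 2.
  rewrite -[eps / 2]invf_div lef_pV2 ?posrE ?divr_gt0 //.
  apply/ltW/(lt_le_trans (archi_boundP _)); first by rewrite divr_ge0 // ltW.
  by rewrite ler_nat.
have roundsP : (potential_bound l)%:R <= rounds%:R * delta.
  rewrite -ler_pdivrMr //.
  apply/ltW/(lt_le_trans (archi_boundP _)); first by rewrite divr_ge0 // ltW.
  by rewrite ler_nat.
exists (local_search l rounds), (time_poly l rounds).
move=> E f g h k f0 fm fs g0 gm gs h0 hc fE.
have run_ok := hoare_local_search g0 gm gs h0 hc k delta0 (ltn0Sn _) roundsP.
split.
  by apply: surely_impl run_ok => s [[cs _] ts]; rewrite time_polyE.
move=> O [cO Omax].
(* Monotonicity allows padding the optimum to the exact size kept by the search. *)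
have [O' OO' cO'] : exists2 O' : {set E}, O \subset O' & #|O'| = minn k #|E|.
  by apply: superset_of_card; rewrite leq_min cO max_card geq_minr.
have fO' : f O = f O'.
  by apply/eqP; rewrite eq_le fm // Omax // cO' geq_minl.
rewrite fO'.
(* Here the curvature may be [-oo], but the product with 0 is 0. *)
have [fO0|fO0] := eqVneq (f O') 0.
  by rewrite fO0 mule0 lee_fin; apply: mean_ge; apply: surely_impl run_ok => s _.
have fO_gt0 : 0 < f O' by rewrite lt_neqAle eq_sym fO0 f0.
have [r -> rle] := curvature_le f0 h0 fO_gt0.
rewrite -EFinM lee_fin.
apply: mean_ge; apply: surely_impl run_ok => s [[_ /(_ O' cO')] opt _].
have {opt} := opt _; rewrite -!fE => opt.
have {}opt : c * f O' - (loss_weight l)%:R * g O' - delta * f O' <= c * f (output s).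
  by apply: opt => X cX; rewrite -fE -fO' Omax // cX geq_minl.
have lossle := loss_weight_le l R; rewrite -/c in lossle.
set e1 := (expR 1)^-1 in lossle *.
have e1_ge0 : 0 <= e1 by rewrite invr_ge0 expR_ge0.
have gle : g O' <= f O' by rewrite fE lerDl.
have h1 : (loss_weight l)%:R * g O' <= c * (e1 + eps / 2) * g O'.
  rewrite ler_wpM2r // (le_trans lossle) //.
  by rewrite mulrC ler_pM2l // -/e1 lerD2l.
(* Only [g] suffers the 1/e loss, and [g O'] is at most the curvature [1 - r] times [f O']. *)
have h2 : e1 * g O' <= e1 * ((1 - r) * f O').
  by rewrite ler_wpM2l // mulrBl mul1r fE; rewrite fE in rle; lra.
have h3 : eps / 2 * g O' <= eps / 2 * f O' by rewrite ler_wpM2l // divr_ge0 // ltW.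
rewrite -(ler_pM2l c0); apply: le_trans opt.
have : c * (e1 * g O' + eps / 2 * g O') <=
       c * (e1 * ((1 - r) * f O') + eps / 2 * f O').
  by rewrite ler_pM2l // lerD.
rewrite /delta; lra.
Qed.
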